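(* Let $w:[0,1]\to[0,1]$ be an increasing weight function such that $w(0)=0$ and $w(1)=1$. Let $u:\mathbb{R}\to\mathbb{R}$ be a continuous, increasing utility function satisfying $u(0)=0$, and assume that $u$ is unbounded above and below. Define $u^+(x)=u(x\mathbf 1\{x\ge0\})$ and $u^-(x)=-u(x\mathbf 1\{x<0\})$ for $x\in\mathbb{R}$. Let $w^-(p)=w(p)$ and $w^+(p)=1-w(1-p)$ for $p\in[0,1]$. Then, for any random variable $X$ with CDF $F$, $$V(F)=\int_0^\infty w^+\left(\mathbb{P}(u^+(X)>z)\right)dz-\int_0^\infty w^-\left(\mathbb{P}(u^-(X)>z)\right)dz.$$
   Context: The rank-dependent expected utility (RDEU) value of a CDF $F$, determined by the weight function $w$ and the utility function $u$, is $V(F)=\int_{-\infty}^\infty u(x)\,d(w\circ F)(x)$. The notation $\mathbf 1\{\cdot\}$ denotes the indicator function. The right-hand side of the displayed identity is the cumulative prospect theory (CPT) value of $X$ with utilities $u^\pm$ and weights $w^\pm$.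
   Formalization: V(F) includes, besides the integral of u over the real line, the mass of w∘F lost at ±∞ times sup u and inf u; these terms vanish when w∘F tends to 0 and 1, and without them the identity fails if w jumps at 0 or 1 (e.g. w(p)=(1+p)/2 for p>0, X normal). *)

(* Defs.v *)
From HB Require Import structures.
From mathcomp Require Import all_boot all_order all_algebra.
From mathcomp Require Import all_classical all_reals all_analysis.
Set Implicit Arguments.
Unset Strict Implicit.
Unset Printing Implicit Defensive.
Import Order.TTheory GRing.Theory Num.Theory.
Import numFieldNormedType.Exports.
Local Open Scope classical_set_scope.
Local Open Scope ring_scope.

(* Only the values on [0, 1] are constrained (or ever used). *)
Record weight (R : realType) := Weight {
  weight_fun :> R -> R ;
  weight_itv : forall p, p \in `[0, 1] -> weight_fun p \in `[0, 1] ;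
  weight_nd : {in `[0, 1] &, {homo weight_fun : p q / p <= q}} ;
  weight0 : weight_fun 0 = 0 ;
  weight1 : weight_fun 1 = 1 }.

Section cdf_bounds.
Context {R : realType} (F : cumulativeBounded (0 : R) (1 : R)).

Lemma CDF_itv x : F x \in `[0, 1].
Proof.
have ndF := cumulative_is_nondecreasing F.
rewrite in_itv/=; apply/andP; split.
  apply: (cvgr_to_le (cumulativeNy F)).
  by near=> y; apply: ndF; near: y; exact: nbhs_ninfty_le.
apply: (cvgr_to_ge (cumulativey F)).
by near=> y; apply: ndF; near: y; exact: nbhs_pinfty_ge.
Unshelve. all: by end_near. Qed.

End cdf_bounds.

Section distorted_measure.
Context {R : realType} (w : weight R) (F : cumulativeBounded (0 : R) (1 : R)).

Definition distort (x : R) : R := w (F x).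

Lemma distort_nd : {homo distort : x y / x <= y}.
Proof.
move=> x y xy; apply: weight_nd; rewrite ?CDF_itv//.
exact: (cumulative_is_nondecreasing F).
Qed.

Lemma distort_ge0 x : 0 <= distort x.
Proof. by have := weight_itv w (CDF_itv F x); rewrite in_itv => /andP[]. Qed.

(* [w \o F] is nondecreasing but need not be right-continuous; its
   Lebesgue-Stieltjes measure is that of its right-continuous version, which
   differs from [w \o F] at countably many points only. *)
Definition distort_rc (x : R) : R := lim (distort y @[y --> x^'+]).

Lemma cvg_distort_rc x : distort y @[y --> x^'+] --> distort_rc x.
Proof.
apply: nondecreasing_at_right_is_cvgr.
  by near=> b => y z _ _; exact: distort_nd.
by near=> b; exists 0 => _ [y _ <-]; exact: distort_ge0.
Unshelve. all: by end_near. Qed.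

Lemma distort_rc_ge x : distort x <= distort_rc x.
Proof.
apply: limr_ge; first exact: cvg_distort_rc.
by near=> y; apply: distort_nd; near: y; exact: nbhs_right_ge.
Unshelve. all: by end_near. Qed.

Lemma distort_rc_le x y : x < y -> distort_rc x <= distort y.
Proof.
move=> xy; apply: limr_le; first exact: cvg_distort_rc.
by near=> z; apply: distort_nd; near: z; exact: nbhs_right_le.
Unshelve. all: by end_near. Qed.

Lemma distort_rc_nd : nondecreasing distort_rc.
Proof.
move=> x y; rewrite le_eqVlt => /predU1P[->//|xy].
exact: le_trans (distort_rc_le xy) (distort_rc_ge y).
Qed.

Lemma distort_rc_right_continuous : right_continuous distort_rc.
Proof.
move=> x; apply/cvgrPdist_le => e e0.
have [z [xz ze]] : exists z, x < z /\ `|distort_rc x - distort z| <= e.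
  apply: (@filter_ex _ (x^'+)); apply: filterI; first exact: nbhs_right_gt.
  by have /cvgrPdist_le := @cvg_distort_rc x; exact.
near=> y; have xy : x < y by [].
have yz : y < z by near: y; exact: nbhs_right_lt.
have le1 : 0 <= distort_rc y - distort_rc x.
  by rewrite subr_ge0 distort_rc_nd// ltW.
have le2 : distort_rc y - distort_rc x <= distort z - distort_rc x.
  by rewrite lerD2r distort_rc_le.
by rewrite distrC ger0_norm// (le_trans le2)// (le_trans _ ze)// distrC ler_norm.
Unshelve. all: by end_near. Qed.

HB.instance Definition _ := isCumulative.Build R _ R distort_rc
  distort_rc_nd distort_rc_right_continuous.

Local Open Scope ereal_scope.

(* Integral of u over [-oo, +oo] against d(w \o F), where F(-oo) = 0,
   F(+oo) = 1 and u(-oo), u(+oo) are the infimum and supremum of u (its limits,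
   u being meant to be nondecreasing).  If w jumps at 0 (resp. at 1) and F does
   not attain 0 (resp. 1), the Lebesgue-Stieltjes measure of w \o F on R has
   total mass < w 1 - w 0 = 1, the rest sitting at -oo (resp. +oo): an integral
   over R alone would lose it.  The two terms at infinity vanish (0 * +oo = 0)
   whenever w \o F has limits 0 and 1, see [rdeuE]. *)
Definition rdeu (u : R -> R) : \bar R :=
  \int[lebesgue_stieltjes_measure distort_rc]_x (u x)%:E
  + (w 1 - lim (distort x @[x --> +oo%R]))%:E * ereal_sup (range (EFin \o u))
  + (lim (distort x @[x --> -oo%R]) - w 0)%:E * ereal_inf (range (EFin \o u)).

Lemma rdeuE (u : R -> R) :
  distort x @[x --> -oo%R] --> (0 : R)%R ->
  distort x @[x --> +oo%R] --> (1 : R)%R ->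
  rdeu u = \int[lebesgue_stieltjes_measure distort_rc]_x (u x)%:E.
Proof.
move=> /cvg_lim lNy /cvg_lim ly; rewrite /rdeu weight0 weight1.
by rewrite lNy// ly// !subrr !mul0e !adde0.
Qed.

End distorted_measure.

Section cpt.
Local Open Scope ereal_scope.
Context d (T : measurableType d) (R : realType) (P : probability T R).

Definition cpt (up um wp wm : R -> R) (X : {RV P >-> R}) : \bar R :=
  \int[lebesgue_measure]_(z in `[0%R, +oo[)
     (wp (fine (P [set t | (z < up (X t))%R])))%:E
  - \int[lebesgue_measure]_(z in `[0%R, +oo[)
     (wm (fine (P [set t | (z < um (X t))%R])))%:E.

End cpt.

Definition upos (R : realType) (u : R -> R) (x : R) : R :=
  u (x * (0 <= x)%R%:R).

Definition uneg (R : realType) (u : R -> R) (x : R) : R :=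
  - u (x * (x < 0)%R%:R).

Definition wneg (R : realType) (w : R -> R) (p : R) : R := w p.

Definition wpos (R : realType) (w : R -> R) (p : R) : R := 1 - w (1 - p).

(* Main.v *)
Require Import Defs.
From mathcomp Require Import all_boot all_order all_algebra.
From mathcomp Require Import all_classical all_reals all_analysis.
From mathcomp Require Import measurable_realfun lra.
Import Order.TTheory GRing.Theory Num.Theory.
Import numFieldNormedType.Exports.
Local Open Scope classical_set_scope.
Local Open Scope ring_scope.

(* Let G be the right-continuous version of w \o F and mu its Lebesgue-Stieltjes
   measure. By the layer-cake formula, the integral of u^+ against mu is the
   integral over z >= 0 of mu (u^+ > z), while the first CPT integral is that of
   w^+ (P (u^+ X > z)). The CPT tail should be the mu-tail plus the mass
   1 - lim_(+oo) (w \o F) sitting at +oo; because G and w \o F may differ at the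
   jumps of w \o F, this holds only up to an arbitrarily small shift of z. As
   the tails are monotone and bounded, the shift does not change the integral.
   The negative parts are dealt with in the same way, at -oo. *)

(** * Layer-cake formula *)

(** Each [f x] is the Lebesgue measure of [[0, f x[]; Tonelli, for which [mu] is taken sigma-finite,
    then exchanges the two integrals. *)
Lemma ge0_integral_tail d (T : measurableType d) (R : realType)
    (mu : {sigma_finite_measure set T -> \bar R}) (f : T -> R) :
    measurable_fun setT f -> (forall x, 0 <= f x) ->
  (\int[mu]_x (f x)%:E =
   \int[lebesgue_measure]_(z in `[0%R, +oo[) mu [set x | (z < f x)%R])%E.
Proof.
move=> mf f0.
transitivity (\int[mu]_x \int[lebesgue_measure]_z
    (\1_`[0, f x[ (z : measurableTypeR R))%:E)%E.
  apply: eq_integral => x _; rewrite integral_indic// setIT.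
  rewrite [RHS]lebesgue_measure_itv/= lte_fin.
  by move: (f0 x); rewrite le_eqVlt => /predU1P[<-|->]; rewrite ?ltxx ?sube0.
rewrite (fubini_tonelli
  (fun p : T * measurableTypeR R => (\1_`[0, f p.1[ p.2)%:E))/=; last first.
- by move=> x; rewrite lee_fin.
- apply/measurable_EFinP/measurable_indic.
  rewrite [X in measurable X](_ : _ =
      (fun p : T * measurableTypeR R => 0 <= p.2) @^-1` [set true] `&`
      (fun p : T * measurableTypeR R => p.2 < f p.1) @^-1` [set true]);
    last first.
    by apply/seteqP; split => p /=; rewrite in_itv/= => /andP.
  by apply: measurableI; rewrite -[X in measurable X]setTI;
    [apply: measurable_fun_ler|apply: measurable_fun_ltr] => //;
    apply: measurableT_comp.
(* For [z >= 0] the inner integral is the measure of a superlevel set; for [z < 0] both sides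
   vanish. *)
rewrite [in RHS]integral_mkcond/=; apply: eq_integral => z _.
rewrite patchE; case: ifPn => [|].
- rewrite inE/= in_itv/= andbT => z0.
  rewrite (eq_integral (fun x => (\1_[set x | z < f x] x)%:E)) => [|x _].
    rewrite integral_indic ?setIT// -[X in measurable X]setTI.
    exact: (@measurable_fun_ltr _ _ _ _ (cst z)).
  rewrite !indicE; congr (_%:R%:E)%E; congr nat_of_bool.
  by apply/idP/idP; rewrite !inE/= in_itv/= z0.
- rewrite notin_setE/= in_itv/= andbT => /negP; rewrite -ltNge => z0.
  by apply: integral0_eq => x _; rewrite indicE memNset//= in_itv/= leNgt z0.
Qed.

(** * Translation and comparison of integrals of monotone functions *)

Section shifts.
Local Open Scope ereal_scope.
Context {R : realType}.

(** Lebesgue measure agrees with its pushforward under [x + e] on all intervals []a, b]], hence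
    everywhere by uniqueness; the formula is then a change of variables. *)
Lemma ge0_integral_shift (f : R -> \bar R) (e : R) :
    measurable_fun setT f -> (forall x, 0 <= f x) ->
  \int[lebesgue_measure]_(x in `[e, +oo[) f x =
  \int[lebesgue_measure]_(x in `[0%R, +oo[) f (x + e)%R.
Proof.
move=> mf f0; pose T := measurableTypeR R; pose phi (x : T) : T := (x + e)%R.
have mphi : measurable_fun setT phi by exact: measurable_funD.
transitivity (\int[pushforward lebesgue_measure phi]_(x in `[e, +oo[) f x).
  apply: eq_measure_integral => A mA _.
  apply: lebesgue_measure_unique => // _ [[a b]] _ <-.
  have phiE : phi @^-1` `]a, b]%classic = `](a - e)%R, (b - e)%R]%classic.
    by apply/seteqP; split=> x; rewrite /phi/= !in_itv/= ltrBlDr lerBrDr.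
  rewrite [RHS](_ : _ = lebesgue_measure (phi @^-1` `]a, b]))// phiE.
  rewrite [LHS]lebesgue_measure_itv [RHS]lebesgue_measure_itv/= !lte_fin ltrD2r.
  by case: ifP => // _; rewrite -!EFinB; congr EFin; lra.
rewrite ge0_integral_pushforward//; last exact: measurable_funS mf.
rewrite (_ : phi @^-1` _ = `[0%R, +oo[%classic)//.
by apply/seteqP; split=> x; rewrite /phi/= !in_itv/= !andbT lerDr.
Qed.

(** For every [e > 0], the part of the left integral over [[0, e[] is at most [e] because [f <= 1],
    and the part over [[e, +oo[], translated by [e], is controlled by [f (z + e) <= g z]. Then let
    [e] tend to 0. *)
Lemma le_integral_interleaved (f g : R -> R) :
    nonincreasing_fun f -> nonincreasing_fun g ->
    (forall z, 0 <= f z)%R -> (forall z, 0 <= g z)%R ->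
    (forall z, 0 <= z -> f z <= 1)%R ->
    (forall z z', 0 <= z -> z < z' -> f z' <= g z)%R ->
  \int[lebesgue_measure]_(z in `[0%R, +oo[) (f z)%:E <=
  \int[lebesgue_measure]_(z in `[0%R, +oo[) (g z)%:E.
Proof.
move=> nif nig f0 g0 f1 fg.
have mE (D : set R) (h : R -> R) :
    measurable D -> nonincreasing_fun h -> measurable_fun D (EFin \o h).
  by move=> mD nih; apply/measurable_EFinP; exact: nonincreasing_measurable.
apply/lee_addgt0Pr => e e0; rewrite addeC.
have split0 : `[0%R, +oo[%classic = `[0%R, e[ `|` `[e, +oo[ :> set R.
  by rewrite -itv_bndbnd_setU// bnd_simp ltW.
rewrite {1}split0 ge0_integral_setU//=; last first.
- apply/disj_setPS => z []/=; rewrite !in_itv/= andbT => /andP[_].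
  by rewrite ltNge => /negP.
- by move=> z _; rewrite lee_fin.
- by apply: (mE _ f) => //; exact: measurableU.
apply: leeD.
  rewrite [leRHS](_ : _ = \int[lebesgue_measure]_(z in `[0%R, e[) cst 1 z).
    apply: ge0_le_integral => //=.
    - by move=> z _; rewrite lee_fin.
    - exact: (mE _ f).
    - by move=> z; rewrite /= in_itv/= lee_fin => /andP[/f1].
  by rewrite integral_cst// mul1e [RHS]lebesgue_measure_itv/= lte_fin e0 sube0.
rewrite ge0_integral_shift//; last exact: (mE _ f).
apply: ge0_le_integral => //=.
- by move=> z _; rewrite lee_fin.
- apply: (mE _ (fun z => f (z + e)%R)) => // x y xy.
  by apply: nif; rewrite lerD2r.
- exact: (mE _ g).
- move=> z; rewrite in_itv/= andbT => z0; rewrite lee_fin.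
  by apply: fg => //; rewrite ltrDl.
Qed.

End shifts.

(** * Lebesgue-Stieltjes measure of half-lines *)

Section lebesgue_stieltjes_tails.
Local Open Scope ereal_scope.
Context {R : realType} (f : cumulative R R).
Let mu := lebesgue_stieltjes_measure f.

Lemma lebesgue_stieltjes_measure_oc (a b : R) : (a <= b)%R ->
  mu `]a, b] = (f b - f a)%:E.
Proof.
move=> ab; rewrite /mu /lebesgue_stieltjes_measure /measure_extension/=.
by rewrite measurable_mu_extE/= ?wlength_itv_bnd//; exact: is_ocitv.
Qed.

Lemma lebesgue_stieltjes_measure_oy (l a : R) : f x @[x --> +oo%R] --> l ->
  mu `]a, +oo[ = (l - f a)%:E.
Proof.
move=> fl; rewrite itv_bndy_bigcup_BRight.
have : mu `]a, (a + n%:R)%R] @[n --> \oo] --> (l - f a)%:E.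
  have -> : (fun n : nat => mu `]a, (a + n%:R)%R]) =
            (fun n : nat => (f (a + n%:R)%R - f a)%:E).
    by apply/funext => n; rewrite lebesgue_stieltjes_measure_oc// lerDl.
  apply: cvg_EFin; first by near=> n.
  apply: cvgB; last exact: cvg_cst.
  apply: (cvg_comp _ _ _ fl).
  by apply: (cvg_comp _ _ cvgr_idn); exact: cvg_addrl.
apply: cvg_unique => //.
apply: nondecreasing_cvg_mu => //; first exact: bigcup_measurable.
by move=> m n mn; apply/subsetPset/subset_itvl; rewrite bnd_simp lerD2l ler_nat.
Unshelve. all: by end_near. Qed.

Lemma lebesgue_stieltjes_measure_Nyc (l a : R) : f x @[x --> -oo%R] --> l ->
  mu `]-oo, a] = (f a - l)%:E.
Proof.
move=> fl; rewrite itvNybndEbigcup.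
have : mu `](- n%:R)%R, a] @[n --> \oo] --> (f a - l)%:E.
  apply: (@cvg_trans _ ((fun n : nat => (f a - f (- n%:R)%R)%:E) @ \oo)).
    (* The formula for []- n, a]] requires [- n <= a], so the two sequences agree only
       eventually. *)
    apply: near_eq_cvg; near=> n.
    rewrite lebesgue_stieltjes_measure_oc// lerNl.
    by near: n; exact: nbhs_infty_ger.
  apply: cvg_EFin; first by near=> n.
  apply: cvgB; first exact: cvg_cst.
  apply: (cvg_comp _ _ _ fl).
  by apply: (cvg_comp _ _ cvgr_idn); rewrite ninfty.
apply: cvg_unique => //.
apply: nondecreasing_cvg_mu => //; first exact: bigcup_measurable.
move=> m n mn; apply/subsetPset/subset_itv; rewrite ?bnd_simp//.
by rewrite lerN2 ler_nat.
Unshelve. all: by end_near. Qed.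

Lemma lebesgue_stieltjes_measure_lty (l l' : R) :
    f x @[x --> -oo%R] --> l -> f x @[x --> +oo%R] --> l' ->
  forall A, measurable A -> mu A < +oo.
Proof.
move=> fl fl' A mA; apply: (@le_lt_trans _ _ (mu setT)).
  by apply: le_measure; rewrite ?inE.
rewrite (_ : setT = `]-oo, 0%R] `|` `]0%R, +oo[).
  apply: (le_lt_trans (measureU2 _ _ _)) => //.
  have l1 : mu `]-oo, 0%R] < +oo.
    by rewrite (lebesgue_stieltjes_measure_Nyc _ _ fl) ltry.
  have l2 : mu `]0%R, +oo[ < +oo.
    by rewrite (lebesgue_stieltjes_measure_oy _ _ fl') ltry.
  exact: lte_add_pinfty.
by rewrite -itv_bndbnd_setU// set_itvNyy.
Qed.

End lebesgue_stieltjes_tails.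

(** * Limits of the distorted CDF at infinity *)

Section distort_limits.
Context {R : realType} (w : weight R) (F : cumulativeBounded (0 : R) (1 : R)).
Local Notation g := (distort w F).
Local Notation G := (distort_rc w F).

Lemma distort_le1 x : g x <= 1.
Proof. by have := weight_itv w (CDF_itv F x); rewrite in_itv => /andP[]. Qed.

Lemma is_cvg_distort_y : cvg (g x @[x --> +oo]).
Proof.
apply/cvg_ex; exists (sup (range g)); apply: nondecreasing_cvgr.
  exact: distort_nd.
by exists 1 => _ [x _ <-]; exact: distort_le1.
Qed.

Lemma is_cvg_distort_Ny : cvg (g x @[x --> -oo]).
Proof.
(* The reflected function [- g (- x)] is nondecreasing and bounded above, which turns the limit at
   -oo into one at +oo. *)
apply/cvg_ex; exists (- sup (range (fun x => - g (- x)))).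
apply/cvgNy_compNP; rewrite -[X in X @ _ --> _]opprK; apply: cvgN.
apply: nondecreasing_cvgr.
  by move=> x y xy /=; rewrite lerN2 distort_nd// lerN2.
by exists 0 => _ [x _ <-]; rewrite oppr_le0 distort_ge0.
Qed.

(** The squeeze [g x <= G x <= g (x + 1)] gives both versions the same limit; likewise at -oo
    below. *)
Lemma cvg_distort_rc_y : G x @[x --> +oo] --> lim (g x @[x --> +oo]).
Proof.
apply: (@squeeze_cvgr _ _ _ _ g (fun x => g (x + 1))).
- by near=> x; rewrite distort_rc_ge distort_rc_le// ltrDl.
- exact: is_cvg_distort_y.
- rewrite cvg_shiftr; exact: is_cvg_distort_y.
Unshelve. all: by end_near. Qed.

Lemma cvg_distort_rc_Ny : G x @[x --> -oo] --> lim (g x @[x --> -oo]).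
Proof.
apply: (@squeeze_cvgr _ _ _ _ g (fun x => g (x + 1))).
- by near=> x; rewrite distort_rc_ge distort_rc_le// ltrDl.
- exact: is_cvg_distort_Ny.
- apply: (cvg_comp _ _ (cvg_addrr_Ny _)); exact: is_cvg_distort_Ny.
Unshelve. all: by end_near. Qed.

Lemma lim_distort_y_le1 : lim (g x @[x --> +oo]) <= 1.
Proof.
apply: limr_le; first exact: is_cvg_distort_y.
by near=> x; exact: distort_le1.
Unshelve. all: by end_near. Qed.

Lemma lim_distort_Ny_ge0 : 0 <= lim (g x @[x --> -oo]).
Proof.
apply: limr_ge; first exact: is_cvg_distort_Ny.
by near=> x; exact: distort_ge0.
Unshelve. all: by end_near. Qed.

End distort_limits.

(** * Positive and negative parts of the utility *)

Section utility.
Context {R : realType} (u : R -> R).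
Context (u_incr : {homo u : x y / x <= y}) (u0 : u 0 = 0).

(** Since [u] is monotone with [u 0 = 0], its sign follows that of [x], so truncating the argument
    amounts to truncating the value. *)
Lemma uposE x : upos u x = Num.max (u x) 0.
Proof.
rewrite /upos; have [x0|x0] := leP 0 x.
  by rewrite mulr1 max_l// -u0 u_incr.
by rewrite mulr0 u0 max_r// -u0 u_incr// ltW.
Qed.

Lemma unegE x : uneg u x = Num.max (- u x) 0.
Proof.
rewrite /uneg; have [x0|x0] := leP 0 x.
  by rewrite mulr0 u0 oppr0 max_r// oppr_le0 -u0 u_incr.
by rewrite mulr1 max_l// oppr_ge0 -u0 u_incr// ltW.
Qed.

Lemma upos_gt_supset (z a : R) :
  z < u a -> `]a, +oo[ `<=` [set x | z < upos u x].
Proof.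
move=> zua x; rewrite /= in_itv/= andbT => ax.
by rewrite uposE lt_max (lt_le_trans zua)// u_incr// ltW.
Qed.

Lemma upos_gt_subset (z a : R) : 0 <= z -> u a <= z ->
  [set x | z < upos u x] `<=` `]a, +oo[.
Proof.
move=> z0 uaz x; rewrite /= in_itv/= andbT uposE lt_max [z < 0]ltNge z0 orbF.
move=> zux; rewrite ltNge; apply: contraTN (le_lt_trans uaz zux) => /u_incr.
by rewrite leNgt.
Qed.

(** The bracketing half-lines are closed at [a] so that their probability is exactly [F a]. *)
Lemma uneg_gt_supset (z a : R) :
  z < - u a -> `]-oo, a] `<=` [set x | z < uneg u x].
Proof.
move=> zua x; rewrite /= in_itv/= => xa.
by rewrite unegE lt_max (lt_le_trans zua)// lerN2 u_incr.
Qed.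

Lemma uneg_gt_subset (z a : R) : 0 <= z -> - u a <= z ->
  [set x | z < uneg u x] `<=` `]-oo, a].
Proof.
move=> z0 uaz x; rewrite /= in_itv/= unegE lt_max [z < 0]ltNge z0 orbF.
move=> zux; rewrite leNgt; apply: contraTN (le_lt_trans uaz zux) => /ltW/u_incr.
by rewrite ltrN2 leNgt.
Qed.

Lemma measurable_upos : measurable_fun setT (upos u).
Proof.
rewrite (_ : upos u = fun x => Num.max (u x) 0); last exact/funext/uposE.
apply: measurable_maxr => //; exact: nondecreasing_measurable.
Qed.

Lemma measurable_uneg : measurable_fun setT (uneg u).
Proof.
rewrite (_ : uneg u = fun x => Num.max (- u x) 0); last exact/funext/unegE.
apply: measurable_maxr => //; apply: measurableT_comp => //.
exact: nondecreasing_measurable.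
Qed.

Lemma continuous_unbounded_surj (u_cont : continuous u)
    (uy : ~ has_ubound (range u)) (uNy : ~ has_lbound (range u)) (y : R) :
  exists x, u x = y.
Proof.
have [b yub] : exists b, y <= u b.
  apply: contra_notP uy => /forallNP yu; exists y => _ [x _ <-].
  by have /negP := yu x; rewrite -ltNge => /ltW.
have [a uay] : exists a, u a <= y.
  apply: contra_notP uNy => /forallNP yu; exists y => _ [x _ <-].
  by have /negP := yu x; rewrite -ltNge => /ltW.
have [ab|/ltW/u_incr ba] := leP a b.
  have [||x _ ux] := @IVT _ u a b y ab; last by exists x.
  - exact: continuous_subspaceT.
  - by rewrite min_l ?u_incr// uay max_r ?u_incr// yub.
(* If [b < a], monotonicity forces [u b <= u a <= y <= u b]. *)
by exists b; apply/eqP; rewrite eq_le yub (le_trans ba).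
Qed.

(** The strict gap [a < a'] is what later absorbs the difference between [g] and [G], through
    [G a <= g a']. *)
Lemma continuous_unbounded_two_between (u_cont : continuous u)
    (uy : ~ has_ubound (range u)) (uNy : ~ has_lbound (range u)) (y y' : R) :
  y < y' ->
  exists a a', [/\ a < a', y < u a & u a' < y'].
Proof.
move=> yy'; have surj := continuous_unbounded_surj u_cont uy uNy.
(* The values at one and two thirds of the way from [y] to [y'] are attained; as [u] is monotone,
   [u a < u a'] forces [a < a']. *)
have [a ua] := surj (y + (y' - y) / 3).
have [a' ua'] := surj (y + (y' - y) / 3 * 2).
exists a, a'; split; [|lra|lra].
by rewrite ltNge; apply/negP => /u_incr; rewrite ua ua'; lra.
Qed.

Lemma integral_upos_uneg (f : cumulative R R)
    (mu := lebesgue_stieltjes_measure f) :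
  (\int[mu]_x (u x)%:E = \int[mu]_x (upos u x)%:E - \int[mu]_x (uneg u x)%:E)%E.
Proof.
rewrite integralE; congr (_ - _)%E; apply: eq_integral => x _.
  by rewrite funeposE uposE// EFin_max.
by rewrite funenegE unegE// EFin_max.
Qed.

End utility.

(** * Tails of a finite measure with extra mass at infinity *)

Section tails.
Context {d : measure_display} {T : measurableType d} {R : realType}.
Local Open Scope ereal_scope.

Lemma measurable_gt_set (h : T -> R) (z : R) :
  measurable_fun setT h -> measurable [set x | (z < h x)%R].
Proof.
move=> mh; rewrite -[X in measurable X]setTI.
exact: (@measurable_fun_ltr _ _ _ _ (cst z)).
Qed.

Lemma fine_tail_nonincreasing (mu : {measure set T -> \bar R}) (h : T -> R) :
    measurable_fun setT h -> (forall A, measurable A -> mu A < +oo) ->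
  nonincreasing_fun (fun z => fine (mu [set x | (z < h x)%R])).
Proof.
move=> mh muoo z z' zz'; have mz := measurable_gt_set h _ mh.
apply: fine_le; rewrite ?ge0_fin_numE ?muoo//.
by apply: le_measure; rewrite ?inE// => x /=; exact: le_lt_trans.
Qed.

(** Here [k] stands for a CPT integrand and [c] for the mass lost at infinity. Interleaving in both
    directions lets [c] plus the [mu]-tail replace [k]; the layer-cake formula then integrates the
    tail. *)
Lemma integral_interleaved_tail
    (mu : {sigma_finite_measure set T -> \bar R}) (h : T -> R)
    (k : R -> R) (c : R) :
    measurable_fun setT h -> (forall x, 0 <= h x)%R ->
    (forall A, measurable A -> mu A < +oo) -> (0 <= c)%R ->
    nonincreasing_fun k -> (forall z, 0 <= k z <= 1)%R ->
    (forall z, 0 <= z -> c + fine (mu [set x | z < h x]) <= 1)%R ->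
    (forall z z', 0 <= z -> z < z' ->
      k z' <= c + fine (mu [set x | z < h x]))%R ->
    (forall z z', 0 <= z -> z < z' ->
      c + fine (mu [set x | z' < h x]) <= k z)%R ->
  \int[lebesgue_measure]_(z in `[0%R, +oo[) (k z)%:E =
  \int[mu]_x (h x)%:E + c%:E * +oo.
Proof.
move=> mh h0 muoo c0 nik k01 m1 km mk.
pose m z : R := (fine (mu [set x | z < h x]))%R.
have nim : nonincreasing_fun m by exact: fine_tail_nonincreasing.
have mm : measurable_fun (`[0%R, +oo[ : set R) (EFin \o m).
  by apply/measurable_EFinP; exact: nonincreasing_measurable.
have m0 z : (0 <= m z)%R by rewrite fine_ge0.
transitivity (\int[lebesgue_measure]_(z in `[0%R, +oo[) (c + m z)%:E).
  have nicm : nonincreasing_fun (fun z => c + m z)%R.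
    by move=> z z' /nim; rewrite lerD2l.
  have cm0 z : (0 <= c + m z)%R by rewrite addr_ge0.
  have k0 z : (0 <= k z)%R by case/andP: (k01 z).
  apply/le_anti/andP; split; apply: le_integral_interleaved => //.
  by move=> z _; case/andP: (k01 z).
under eq_integral do rewrite EFinD.
rewrite ge0_integralD//; last by move=> z _; rewrite lee_fin.
(* The constant [c] over [[0, +oo[] contributes [c * +oo], which is 0 when [c = 0]. *)
rewrite (integral_cst _ _ c%:E)//= lebesgue_measure_itv/= ltry addye// addeC.
congr (_ + _); rewrite ge0_integral_tail//; apply: eq_integral => z _.
by rewrite /m fineK// ge0_fin_numE ?muoo//; exact: measurable_gt_set.
Qed.

End tails.

(** * The two CPT integrals in terms of the Lebesgue-Stieltjes measure *)

Section parts.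
Context {R : realType} (w : weight R) (u : R -> R).
Context (u_cont : continuous u) (u_incr : {homo u : x y / x <= y}).
Context (u0 : u 0 = 0).
Context (uy : ~ has_ubound (range u)) (uNy : ~ has_lbound (range u)).
Context (d : measure_display) (T : measurableType d) (P : probability T R).
Context (X : {RV P >-> R}) (F : cumulativeBounded (0 : R) (1 : R)).
Context (F_cdf : forall x, cdf X x = (F x)%:E).

Let g := distort w F.
Let G := distort_rc w F.
Let mu := lebesgue_stieltjes_measure (distort_rc w F).
Let Ly := lim (distort w F x @[x --> +oo]).
Let LNy := lim (distort w F x @[x --> -oo]).
Let mu_lty := lebesgue_stieltjes_measure_lty _ _ _
  (cvg_distort_rc_Ny w F) (cvg_distort_rc_y w F).
Let two_between :=
  continuous_unbounded_two_between _ u_incr u_cont uy uNy.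

Lemma wpos01 p : p \in `[0, 1] -> 0 <= wpos w p <= 1.
Proof.
rewrite in_itv/= => /andP[p0 p1].
have := @weight_itv _ w (1 - p); rewrite !in_itv/= /wpos => /(_ _)/andP[|]; lra.
Qed.

Lemma wpos_nd : {in `[0, 1] &, {homo wpos w : p q / p <= q}}.
Proof.
move=> p q; rewrite !in_itv/= => /andP[p0 p1] /andP[q0 q1] pq.
by rewrite /wpos lerD2l lerN2; apply: weight_nd; rewrite ?in_itv/=; lra.
Qed.

Lemma fine_probability_itv A : measurable A -> fine (P A) \in `[0, 1].
Proof.
move=> mA; rewrite in_itv/= fine_ge0//= -lee_fin fineK ?fin_num_measure//.
exact: probability_le1.
Qed.

Lemma fine_probability_le A B : measurable A -> measurable B -> A `<=` B ->
  fine (P A) <= fine (P B).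
Proof.
by move=> mA mB AB; rewrite fine_le ?fin_num_measure// le_measure ?inE.
Qed.

Lemma fine_mu_le A B : measurable A -> measurable B -> A `<=` B ->
  fine (mu A) <= fine (mu B).
Proof.
move=> mA mB AB; rewrite fine_le ?ge0_fin_numE ?mu_lty//.
by apply: le_measure; rewrite ?inE.
Qed.

Lemma fine_probability_oy a : fine (P (X @^-1` `]a, +oo[)) = 1 - F a.
Proof. by rewrite -[LHS]/(fine (ccdf X a)) ccdf_1_cdf F_cdf. Qed.

Lemma fine_probability_Nyc a : fine (P (X @^-1` `]-oo, a])) = F a.
Proof. by rewrite -[LHS]/(fine (cdf X a)) F_cdf. Qed.

Lemma fine_mu_oy a : fine (mu `]a, +oo[) = Ly - G a.
Proof.
by rewrite /mu (lebesgue_stieltjes_measure_oy _ _ _ (cvg_distort_rc_y w F)).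
Qed.

Lemma fine_mu_Nyc a : fine (mu `]-oo, a]) = G a - LNy.
Proof.
by rewrite /mu (lebesgue_stieltjes_measure_Nyc _ _ _ (cvg_distort_rc_Ny w F)).
Qed.

Lemma CDF01 a : 0 <= F a <= 1.
Proof. by have := CDF_itv F a; rewrite in_itv. Qed.

Lemma distort_rc_le1 a : G a <= 1.
Proof.
by rewrite (le_trans _ (distort_le1 w F (a + 1)))// distort_rc_le// ltrDl.
Qed.

Local Notation mX := (measurable_funPTI X).

(** Take [c = 1 - Ly]. The half-line []a, +oo[] has [wpos]-weight [1 - g a] under [P], while [c]
    plus its [mu]-measure [Ly - G a] is [1 - G a]; only [g] and [G] remain to be compared. *)
Lemma integral_wpos :
  (\int[lebesgue_measure]_(z in `[0%R, +oo[)
     (wpos w (fine (P [set t | (z < upos u (X t))%R])))%:E =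
   \int[mu]_x (upos u x)%:E + (1 - Ly)%:E * +oo)%E.
Proof.
have mup := measurable_upos _ u_incr u0.
have mset z : measurable [set x | z < upos u x] by exact: measurable_gt_set.
have Ly1 : Ly <= 1 by exact: lim_distort_y_le1.
pose p z := fine (P (X @^-1` [set x | z < upos u x])).
have p01 z : p z \in `[0, 1] by apply: fine_probability_itv; exact: mX.
have pge a z : z < u a -> 1 - F a <= p z.
  move=> zua; rewrite -fine_probability_oy.
  apply: fine_probability_le; [exact: mX|exact: mX|].
  by apply: preimage_subset; exact: upos_gt_supset.
have ple a z : 0 <= z -> u a <= z -> p z <= 1 - F a.
  move=> z0 uaz; rewrite -fine_probability_oy.
  apply: fine_probability_le; [exact: mX|exact: mX|].
  by apply: preimage_subset; exact: upos_gt_subset.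
pose m z := fine (mu [set x | z < upos u x]).
have mge a z : z < u a -> Ly - G a <= m z.
  by move=> zua; rewrite -fine_mu_oy; apply: fine_mu_le;
    [exact: measurable_itv|exact: mset|exact: upos_gt_supset].
have mle a z : 0 <= z -> u a <= z -> m z <= Ly - G a.
  by move=> z0 uaz; rewrite -fine_mu_oy; apply: fine_mu_le;
    [exact: mset|exact: measurable_itv|exact: upos_gt_subset].
have F01 a : 1 - F a \in `[0, 1] by rewrite in_itv/=; have := CDF01 a; lra.
have wF a : wpos w (1 - F a) = 1 - g a by rewrite /wpos subKr.
apply: (integral_interleaved_tail mu _ (wpos w \o p)) => //=.
- by move=> x; rewrite uposE// le_max lexx orbT.
- by rewrite subr_ge0.
- move=> z z' zz'; apply: wpos_nd => //.
  apply: fine_probability_le; [exact: mX|exact: mX|].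
  by move=> t /=; exact: le_lt_trans.
- by move=> z; exact: wpos01.
(* The choice [a = 0] bounds the sum by [1 - G 0], and [G 0 >= g 0 >= 0]. *)
- move=> z z0; have := mle 0 z z0; rewrite u0 => /(_ z0).
  have := distort_ge0 w F 0; have := distort_rc_ge w F 0.
  rewrite /m -/G -/g; lra.
(* The chain is [wpos w (p z') <= 1 - g a' <= 1 - G a <= 1 - Ly + m z]. *)
- move=> z z' z0 zz'; have z'0 : 0 <= z' by exact: le_trans z0 (ltW zz').
  have [a [a' [aa' zua ua'z']]] := two_between _ _ zz'.
  have := wpos_nd _ _ (p01 _) (F01 _) (ple _ _ z'0 (ltW ua'z')); rewrite wF.
  have := mge _ _ zua; have := distort_rc_le w F aa'; rewrite -/G -/g /m; lra.
(* The chain is [1 - Ly + m z' <= 1 - G a' <= 1 - g a' <= 1 - g a <= wpos w (p z)]. *)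
- move=> z z' z0 zz'; have z'0 : 0 <= z' by exact: le_trans z0 (ltW zz').
  have [a [a' [aa' zua ua'z']]] := two_between _ _ zz'.
  have := wpos_nd _ _ (F01 _) (p01 _) (pge _ _ zua); rewrite wF.
  have := mle _ _ z'0 (ltW ua'z'); have := distort_rc_ge w F a'.
  have := distort_nd w F (ltW aa'); rewrite -/G -/g /m; lra.
Qed.

(** Take [c = LNy]. The half-line []-oo, a]] has weight [g a] under [P], and [c] plus its
    [mu]-measure [G a - LNy] is [G a]. *)
Lemma integral_wneg :
  (\int[lebesgue_measure]_(z in `[0%R, +oo[)
     (wneg w (fine (P [set t | (z < uneg u (X t))%R])))%:E =
   \int[mu]_x (uneg u x)%:E + LNy%:E * +oo)%E.
Proof.
have mun := measurable_uneg _ u_incr u0.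
have mset z : measurable [set x | z < uneg u x] by exact: measurable_gt_set.
have LNy0 : 0 <= LNy by exact: lim_distort_Ny_ge0.
pose p z := fine (P (X @^-1` [set x | z < uneg u x])).
have p01 z : p z \in `[0, 1] by apply: fine_probability_itv; exact: mX.
have pge a z : z < - u a -> F a <= p z.
  move=> zua; rewrite -fine_probability_Nyc.
  apply: fine_probability_le; [exact: mX|exact: mX|].
  by apply: preimage_subset; exact: uneg_gt_supset.
have ple a z : 0 <= z -> - u a <= z -> p z <= F a.
  move=> z0 uaz; rewrite -fine_probability_Nyc.
  apply: fine_probability_le; [exact: mX|exact: mX|].
  by apply: preimage_subset; exact: uneg_gt_subset.
pose m z := fine (mu [set x | z < uneg u x]).
have mge a z : z < - u a -> G a - LNy <= m z.
  by move=> zua; rewrite -fine_mu_Nyc; apply: fine_mu_le;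
    [exact: measurable_itv|exact: mset|exact: uneg_gt_supset].
have mle a z : 0 <= z -> - u a <= z -> m z <= G a - LNy.
  by move=> z0 uaz; rewrite -fine_mu_Nyc; apply: fine_mu_le;
    [exact: mset|exact: measurable_itv|exact: uneg_gt_subset].
have F01 a : F a \in `[0, 1] by exact: CDF_itv.
apply: (integral_interleaved_tail mu _ (wneg w \o p)) => //=.
- by move=> x; rewrite unegE// le_max lexx orbT.
- move=> z z' zz'; apply: weight_nd => //.
  apply: fine_probability_le; [exact: mX|exact: mX|].
  by move=> t /=; exact: le_lt_trans.
- by move=> z; have := weight_itv w (p01 z); rewrite in_itv.
- move=> z z0; have := mle 0 z z0; rewrite u0 oppr0 => /(_ z0).
  have := distort_rc_le1 0; rewrite /m; lra.
(* With [- z' < u a <= u a' < - z], the chain is [w (p z') <= g a <= G a <= LNy + m z]. *)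
- move=> z z' z0 zz'; have z'0 : 0 <= z' by exact: le_trans z0 (ltW zz').
  move: zz'; rewrite -ltrN2 => /two_between[a [a' [aa' zua ua'z']]].
  have : w (p z') <= g a by apply: weight_nd => //; apply: ple => //; lra.
  have : z < - u a by have := u_incr _ _ (ltW aa'); lra.
  by move=> /mge; have := distort_rc_ge w F a; rewrite -/G -/g /m /wneg; lra.
(* Conversely, [LNy + m z' <= G a <= g a' <= w (p z)]. *)
- move=> z z' z0 zz'; have z'0 : 0 <= z' by exact: le_trans z0 (ltW zz').
  move: zz'; rewrite -ltrN2 => /two_between[a [a' [aa' zua ua'z']]].
  have : g a' <= w (p z) by apply: weight_nd => //; apply: pge; lra.
  have : - u a <= z' by lra.
  move=> /(mle a z' z'0); have := distort_rc_le w F aa'.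
  by rewrite -/G -/g /m /wneg; lra.
Qed.

End parts.

(** * Assembling the two parts and the terms at infinity *)

Theorem lemma18 (R : realType) (w : weight R) (u : R -> R)
    (u_cont : continuous u)
    (u_incr : {homo u : x y / x <= y})
    (u0 : u 0 = 0)
    (u_unbounded_above : ~ has_ubound (range u))
    (u_unbounded_below : ~ has_lbound (range u))
    (d : measure_display) (T : measurableType d) (P : probability T R)
    (X : {RV P >-> R}) (F : cumulativeBounded (0 : R) (1 : R))
    (F_cdf : forall x, cdf X x = (F x)%:E) :
  rdeu w F u = cpt (upos u) (uneg u) (wpos w) (wneg w) X.
Proof.
have surj :=
  continuous_unbounded_surj _ u_incr u_cont u_unbounded_above u_unbounded_below.
have supE : ereal_sup (range (EFin \o u)) = +oo%E.
  apply/eqyP => r _; have [x <-] := surj r.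
  by apply: ereal_sup_ubound; exists x.
have infE : ereal_inf (range (EFin \o u)) = -oo%E.
  have infle r : (ereal_inf (range (EFin \o u)) <= r%:E)%E.
    by have [x <-] := surj r; apply: ereal_inf_lbound; exists x.
  (* A finite infimum [s] would be at most [s - 1], and an infimum [+oo] at most 0. *)
  case: (ereal_inf _) infle => [s /(_ (s - 1))|/(_ 0)|//].
    by rewrite lee_fin leNgt ltrBlDr ltrDl ltr01.
  by rewrite leye_eq.
rewrite /rdeu /cpt supE infE weight0 weight1 subr0.
rewrite (integral_wpos w _ u_cont u_incr u0 u_unbounded_above u_unbounded_below
  _ _ _ _ _ F_cdf).
rewrite (integral_wneg w _ u_cont u_incr u0 u_unbounded_above u_unbounded_below
  _ _ _ _ _ F_cdf).
rewrite (integral_upos_uneg _ u_incr u0).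
set mu := lebesgue_stieltjes_measure _.
set LNy := lim (distort w F x @[x --> -oo]).
have In0 : (0 <= \int[mu]_x (uneg u x)%:E)%E.
  by apply: integral_ge0 => x _; rewrite lee_fin unegE// le_max lexx orbT.
have LNy0 : (0 <= LNy%:E * +oo :> \bar R)%E.
  by rewrite mule_ge0// lee_fin lim_distort_Ny_ge0.
(* Nonnegativity of both summands lets the negation distribute. The final regrouping needs no
   finiteness, since addition on [\bar R] is associative and commutative even when opposite
   infinities meet. *)
rewrite oppeD ?ge0_adde_def// -[-oo%E]/(- +oo)%E muleN.
by rewrite addeACA addeA.
Qed.
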